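(* Let $(\mathfrak{L},\{\cdot,\cdot,\cdot\})$ be a Leibniz triple system and $(r,m,l)$ a representation of $\mathfrak{L}$ on a vector space $V$. A linear map $T:V\to\mathfrak{L}$ is a relative Rota-Baxter operator on $(\mathfrak{L},\{\cdot,\cdot,\cdot\})$ with respect to $(r,m,l)$ if and only if the linear map $\widetilde{T}=\begin{pmatrix}\mathrm{id}&T\\0&0\end{pmatrix}:\mathfrak{L}\oplus V\to\mathfrak{L}\oplus V$, i.e. $\widetilde{T}(x+u)=x+Tu$ for $x\in\mathfrak{L}$, $u\in V$, is a Nijenhuis operator on the semi-direct product Leibniz triple system $(\mathfrak{L}\oplus V,\{\cdot,\cdot,\cdot\}_{\mathfrak{L}\oplus V})$.
   Context: All vector spaces are over a fixed arbitrary field $\mathbb{F}$. A Leibniz triple system is a vector space $\mathfrak{L}$ with a trilinear operation $\{\cdot,\cdot,\cdot\}:\mathfrak{L}\times\mathfrak{L}\times\mathfrak{L}\to\mathfrak{L}$ such that for all $a,b,c,d,e\in\mathfrak{L}$: $\{a,b,\{c,d,e\}\}=\{\{a,b,c\},d,e\}-\{\{a,b,d\},c,e\}-\{\{a,b,e\},c,d\}+\{\{a,b,e\},d,c\}$ and $\{a,\{b,c,d\},e\}=\{\{a,b,c\},d,e\}-\{\{a,c,b\},d,e\}-\{\{a,d,b\},c,e\}+\{\{a,d,c\},b,e\}$. A representation of $\mathfrak{L}$ on a vector space $V$ is a triple $(r,m,l)$ of bilinear maps $l,m,r:\mathfrak{L}\times\mathfrak{L}\to\mathrm{End}(V)$ such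 that for all $a,b,c,d\in\mathfrak{L}$: $l(a,\{b,c,d\})=l(\{a,b,c\},d)-l(\{a,c,b\},d)-l(\{a,d,b\},c)+l(\{a,d,c\},b)$; $m(a,d)l(b,c)=m(\{a,b,c\},d)-m(\{a,c,b\},d)-r(c,d)m(a,b)+r(b,d)m(a,c)$; $m(a,d)m(b,c)=r(c,d)l(a,b)-r(c,d)m(a,b)-m(\{a,c,b\},d)+r(b,d)l(a,c)$; $m(a,d)r(b,c)=r(c,d)m(a,b)-r(c,d)l(a,b)-r(b,d)l(a,c)+m(\{a,c,b\},d)$; $r(\{a,b,c\},d)=r(c,d)r(a,b)-r(c,d)r(b,a)-r(b,d)r(c,a)+r(a,d)r(c,b)$; $l(a,b)l(c,d)=l(\{a,b,c\},d)-l(\{a,b,d\},c)-r(c,d)l(a,b)+r(d,c)l(a,b)$; $l(a,b)m(c,d)=m(\{a,b,c\},d)-r(c,d)l(a,b)-l(\{a,b,d\},c)+m(\{a,b,d\},c)$; $l(a,b)r(c,d)=r(c,d)l(a,b)-m(\{a,b,c\},d)-m(\{a,b,d\},c)+l(\{a,b,d\},c)$; $m(a,\{b,c,d\})=r(c,d)m(a,b)-r(b,d)m(a,c)-r(b,c)m(a,d)+r(c,b)m(a,d)$; $r(a,\{b,c,d\})=r(c,d)r(a,b)-r(b,d)r(a,c)-r(b,c)r(a,d)+r(c,b)r(a,d)$. Equivalently, $\mathfrak{L}\oplus V$ with $\{x+u,y+v,z+w\}_{\mathfrak{L}\oplus V}=\{x,y,z\}+l(x,y)w+m(x,z)v+r(y,z)u$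 ($x,y,z\in\mathfrak{L}$, $u,v,w\in V$) is a Leibniz triple system, called the semi-direct product. A relative Rota-Baxter operator on $(\mathfrak{L},\{\cdot,\cdot,\cdot\})$ with respect to $(r,m,l)$ is a linear map $T:V\to\mathfrak{L}$ with $\{Tu,Tv,Tw\}=T\big(l(Tu,Tv)w+m(Tu,Tw)v+r(Tv,Tw)u\big)$ for all $u,v,w\in V$. A Nijenhuis operator on a Leibniz triple system $(\mathfrak{L},\{\cdot,\cdot,\cdot\})$ is a linear map $N:\mathfrak{L}\to\mathfrak{L}$ such that for all $x,y,z\in\mathfrak{L}$: $\{Nx,Ny,Nz\}=N\{Nx,Ny,z\}+N\{x,Ny,Nz\}+N\{Nx,y,Nz\}-N^2\{Nx,y,z\}-N^2\{x,Ny,z\}-N^2\{x,y,Nz\}+N^3\{x,y,z\}$. *)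

(* Defs.v *)
From HB Require Import structures.
From mathcomp Require Import all_boot all_order all_algebra.

Set Implicit Arguments.
Unset Strict Implicit.
Unset Printing Implicit Defensive.

Import GRing.Theory.
Local Open Scope ring_scope.

Reserved Notation "{[ a , b , c ]}" (at level 0, a, b, c at level 99,
  format "{[ a ,  b ,  c ]}").

HB.mixin Record isLeibnizTripleSystem (F : fieldType) L of GRing.Lmodule F L := {
  triple : L -> L -> L -> L;
  triple_linear1 : forall b c, linear (fun a => triple a b c);
  triple_linear2 : forall a c, linear (fun b => triple a b c);
  triple_linear3 : forall a b, linear (fun c => triple a b c);
  triple_right : forall a b c d e,
    triple a b (triple c d e) =
      triple (triple a b c) d e - triple (triple a b d) c e
      - triple (triple a b e) c d + triple (triple a b e) d c;
  triple_mid : forall a b c d e,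
    triple a (triple b c d) e =
      triple (triple a b c) d e - triple (triple a c b) d e
      - triple (triple a d b) c e + triple (triple a d c) b e
}.

#[short(type="leibnizTripleSystemType")]
HB.structure Definition LeibnizTripleSystem (F : fieldType) :=
  {L of isLeibnizTripleSystem F L & GRing.Lmodule F L}.

Notation "{[ a , b , c ]}" := (triple a b c) : ring_scope.

(* MathComp puts no vector space structure on {linear V -> V}, so bilinearity
   of a map into End(V), and below the identities between endomorphisms, are
   stated after evaluation at an arbitrary vector. *)
Definition bilinear_to_End (F : fieldType) (L V : lmodType F)
    (f : L -> L -> {linear V -> V}) : Prop :=
  (forall b v, linear (fun a => f a b v)) /\
  (forall a v, linear (fun b => f a b v)).

Record representation (F : fieldType) (L : leibnizTripleSystemType F)
    (V : lmodType F) := Representation {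
  rep_r : L -> L -> {linear V -> V};
  rep_m : L -> L -> {linear V -> V};
  rep_l : L -> L -> {linear V -> V};
  rep_r_bilinear : bilinear_to_End rep_r;
  rep_m_bilinear : bilinear_to_End rep_m;
  rep_l_bilinear : bilinear_to_End rep_l;
  rep_l_mid : forall a b c d v,
    rep_l a {[b, c, d]} v =
      rep_l {[a, b, c]} d v - rep_l {[a, c, b]} d v
      - rep_l {[a, d, b]} c v + rep_l {[a, d, c]} b v;
  rep_ml : forall a b c d v,
    rep_m a d (rep_l b c v) =
      rep_m {[a, b, c]} d v - rep_m {[a, c, b]} d v
      - rep_r c d (rep_m a b v) + rep_r b d (rep_m a c v);
  rep_mm : forall a b c d v,
    rep_m a d (rep_m b c v) =
      rep_r c d (rep_l a b v) - rep_r c d (rep_m a b v)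
      - rep_m {[a, c, b]} d v + rep_r b d (rep_l a c v);
  rep_mr : forall a b c d v,
    rep_m a d (rep_r b c v) =
      rep_r c d (rep_m a b v) - rep_r c d (rep_l a b v)
      - rep_r b d (rep_l a c v) + rep_m {[a, c, b]} d v;
  rep_r_mid : forall a b c d v,
    rep_r {[a, b, c]} d v =
      rep_r c d (rep_r a b v) - rep_r c d (rep_r b a v)
      - rep_r b d (rep_r c a v) + rep_r a d (rep_r c b v);
  rep_ll : forall a b c d v,
    rep_l a b (rep_l c d v) =
      rep_l {[a, b, c]} d v - rep_l {[a, b, d]} c v
      - rep_r c d (rep_l a b v) + rep_r d c (rep_l a b v);
  rep_lm : forall a b c d v,
    rep_l a b (rep_m c d v) =
      rep_m {[a, b, c]} d v - rep_r c d (rep_l a b v)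
      - rep_l {[a, b, d]} c v + rep_m {[a, b, d]} c v;
  rep_lr : forall a b c d v,
    rep_l a b (rep_r c d v) =
      rep_r c d (rep_l a b v) - rep_m {[a, b, c]} d v
      - rep_m {[a, b, d]} c v + rep_l {[a, b, d]} c v;
  rep_m_right : forall a b c d v,
    rep_m a {[b, c, d]} v =
      rep_r c d (rep_m a b v) - rep_r b d (rep_m a c v)
      - rep_r b c (rep_m a d v) + rep_r c b (rep_m a d v);
  rep_r_right : forall a b c d v,
    rep_r a {[b, c, d]} v =
      rep_r c d (rep_r a b v) - rep_r b d (rep_r a c v)
      - rep_r b c (rep_r a d v) + rep_r c b (rep_r a d v)
}.

(* rho is a phantom parameter: the bracket on L * V depends on it. *)
Definition semidirect (F : fieldType) (L : leibnizTripleSystemType F)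
  (V : lmodType F) of representation L V : Type := (L * V)%type.

HB.instance Definition _ (F : fieldType) (L : leibnizTripleSystemType F)
    (V : lmodType F) (rho : representation L V) :=
  GRing.Lmodule.copy (semidirect rho) (L * V)%type.

(* Proves an equality of two sums consisting of the same signed terms. *)
Local Ltac perm_sum :=
  rewrite -[LHS]addr0 -[RHS]addr0 -?addrA;
  repeat (lazymatch goal with
    | |- ?x + _ = _ => repeat rewrite [in RHS](addrCA _ x); congr (x + _)
    end); done.

Section SemidirectProduct.
Variables (F : fieldType) (L : leibnizTripleSystemType F) (V : lmodType F).
Variable rho : representation L V.

Definition semidirect_triple (p q s : semidirect rho) : semidirect rho :=
  ({[p.1, q.1, s.1]},
   rep_l rho p.1 q.1 s.2 + rep_m rho p.1 s.1 q.2 + rep_r rho q.1 s.1 p.2).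

Fact semidirect_linear1 q s : linear (fun p => semidirect_triple p q s).
Proof.
move=> k [a u] [a' u']; apply: injective_projections => /=.
  exact: triple_linear1.
rewrite (rep_l_bilinear rho).1 (rep_m_bilinear rho).1 linearP !scalerDr.
perm_sum.
Qed.

Fact semidirect_linear2 p s : linear (fun q => semidirect_triple p q s).
Proof.
move=> k [a u] [a' u']; apply: injective_projections => /=.
  exact: triple_linear2.
rewrite (rep_l_bilinear rho).2 linearP (rep_r_bilinear rho).1 !scalerDr.
perm_sum.
Qed.

Fact semidirect_linear3 p q : linear (fun s => semidirect_triple p q s).
Proof.
move=> k [a u] [a' u']; apply: injective_projections => /=.
  exact: triple_linear3.
rewrite linearP (rep_m_bilinear rho).2 (rep_r_bilinear rho).2 !scalerDr.
perm_sum.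
Qed.

Local Notation tr := semidirect_triple.

Fact semidirect_right (a b c d e : semidirect rho) :
  tr a b (tr c d e) =
    tr (tr a b c) d e - tr (tr a b d) c e
    - tr (tr a b e) c d + tr (tr a b e) d c.
Proof.
apply: injective_projections => /=; first exact: triple_right.
rewrite !linearD /= rep_ll rep_lm rep_lr rep_m_right rep_r_right.
perm_sum.
Qed.

Fact semidirect_mid (a b c d e : semidirect rho) :
  tr a (tr b c d) e =
    tr (tr a b c) d e - tr (tr a c b) d e
    - tr (tr a d b) c e + tr (tr a d c) b e.
Proof.
apply: injective_projections => /=; first exact: triple_mid.
rewrite !linearD /= rep_l_mid rep_ml rep_mm rep_mr rep_r_mid.
perm_sum.
Qed.

HB.instance Definition _ := isLeibnizTripleSystem.Build F (semidirect rho)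
  semidirect_linear1 semidirect_linear2 semidirect_linear3
  semidirect_right semidirect_mid.

Definition relative_rota_baxter (T : {linear V -> L}) : Prop :=
  forall u v w : V,
    {[T u, T v, T w]} =
      T (rep_l rho (T u) (T v) w + rep_m rho (T u) (T w) v
         + rep_r rho (T v) (T w) u).

(* The block matrix with rows (id, T) and (0, 0). *)
Definition tilde_fun (T : {linear V -> L}) (p : semidirect rho) :
  semidirect rho := (p.1 + T p.2, 0).

Fact tilde_fun_linear (T : {linear V -> L}) : linear (tilde_fun T).
Proof.
move=> k [x u] [y v]; apply: injective_projections => /=.
  by rewrite linearP scalerDr addrACA.
by rewrite scaler0 addr0.
Qed.

HB.instance Definition _ (T : {linear V -> L}) :=
  GRing.isLinear.Build F (semidirect rho) (semidirect rho) *:%R (tilde_fun T)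
    (tilde_fun_linear T).

Definition tilde (T : {linear V -> L}) :
  {linear semidirect rho -> semidirect rho} := tilde_fun T.

End SemidirectProduct.

Definition nijenhuis (F : fieldType) (L : leibnizTripleSystemType F)
    (N : {linear L -> L}) : Prop :=
  forall x y z : L,
    {[N x, N y, N z]} =
      N {[N x, N y, z]} + N {[x, N y, N z]} + N {[N x, y, N z]}
      - N (N {[N x, y, z]}) - N (N {[x, N y, z]}) - N (N {[x, y, N z]})
      + N (N (N {[x, y, z]})).

(* Main.v *)
Require Import Defs.
From HB Require Import structures.
From mathcomp Require Import all_boot all_order all_algebra.

Set Implicit Arguments.
Unset Strict Implicit.
Unset Printing Implicit Defensive.

Import GRing.Theory.
Local Open Scope ring_scope.

(** The map N = tilde rho T is idempotent, with image L (a subsystem of the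
    semi-direct product) and kernel the graph {(- T u, u)}, onto which 1 - N
    projects. For any idempotent N, replacing N^2 and N^3 by N turns the
    right-hand side of the Nijenhuis identity into N of an inclusion-exclusion
    sum, which is the expansion of
      {(1 - N) x, (1 - N) y, (1 - N) z} + {N x, N y, N z}.
    When the image of N is a subsystem, N fixes the last bracket, so N is
    Nijenhuis exactly when its kernel is a subsystem too
    ([idempotent_nijenhuis]). Finally, N maps the bracket of (- T u, u),
    (- T v, v), (- T w, w) to
      T (l(Tu,Tv) w + m(Tu,Tw) v + r(Tv,Tw) u) - {Tu, Tv, Tw},
    the two signs inside each of l, m and r cancelling
    ([tilde_triple_kernel]); its vanishing is the relative Rota-Baxter
    identity. *)

Lemma linear_morphN (F : fieldType) (U W : lmodType F) (f : U -> W) :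
  linear f -> {morph f : x / - x}.
Proof.
move=> /GRing.zmod_morphism_linear fB x.
by rewrite -(sub0r x) fB -(subrr 0) fB !subrr !sub0r.
Qed.

Section TripleSigns.
Variables (F : fieldType) (L : leibnizTripleSystemType F).
Implicit Types a b c : L.

Lemma tripleBl a a' b c : {[a - a', b, c]} = {[a, b, c]} - {[a', b, c]}.
Proof. exact: (GRing.zmod_morphism_linear (triple_linear1 b c)). Qed.

Lemma tripleBm a b b' c : {[a, b - b', c]} = {[a, b, c]} - {[a, b', c]}.
Proof. exact: (GRing.zmod_morphism_linear (triple_linear2 a c)). Qed.

Lemma tripleBr a b c c' : {[a, b, c - c']} = {[a, b, c]} - {[a, b, c']}.
Proof. exact: (GRing.zmod_morphism_linear (triple_linear3 a b)). Qed.

Lemma tripleNNN a b c : {[- a, - b, - c]} = - {[a, b, c]}.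
Proof.
rewrite (linear_morphN (triple_linear1 _ _)) (linear_morphN (triple_linear2 _ _)).
by rewrite (linear_morphN (triple_linear3 _ _)) !opprK.
Qed.

Lemma tripleBBB a a' b b' c c' :
  {[a - a', b - b', c - c']} + {[a', b', c']} =
    {[a', b', c]} + {[a, b', c']} + {[a', b, c']}
    - {[a', b, c]} - {[a, b', c]} - {[a, b, c']} + {[a, b, c]}.
Proof.
rewrite tripleBl !tripleBm !tripleBr !opprD !opprK !addrA addrNK.
by rewrite [LHS](ACl (7*4*6*5*3*2*1)).
Qed.

End TripleSigns.

Lemma bilinear_to_EndNN (F : fieldType) (L V : lmodType F)
    (f : L -> L -> {linear V -> V}) (a b : L) (v : V) :
  bilinear_to_End f -> f (- a) (- b) v = f a b v.
Proof.
move=> [lin1 lin2].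
by rewrite (linear_morphN (lin1 _ _)) (linear_morphN (lin2 _ _)) opprK.
Qed.

(** For a projection N onto a subsystem, the Nijenhuis identity says that the
    complementary subspace, the kernel of N, is also closed under brackets. *)
Lemma idempotent_nijenhuis (F : fieldType) (L : leibnizTripleSystemType F)
    (N : {linear L -> L}) :
  (forall x, N (N x) = N x) ->
  (forall x y z, N {[N x, N y, N z]} = {[N x, N y, N z]}) ->
  nijenhuis N <-> forall x y z, N {[x - N x, y - N y, z - N z]} = 0.
Proof.
move=> NN Nsub.
have rhsE x y z :
    N {[N x, N y, z]} + N {[x, N y, N z]} + N {[N x, y, N z]}
    - N (N {[N x, y, z]}) - N (N {[x, N y, z]}) - N (N {[x, y, N z]})
    + N (N (N {[x, y, z]}))
    = N {[x - N x, y - N y, z - N z]} + {[N x, N y, N z]}.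
  by rewrite !NN -[in RHS]Nsub -[in RHS]linearD tripleBBB !(linearD, linearN).
split=> [nijN x y z | kerN x y z].
  by apply: (addIr {[N x, N y, N z]}); rewrite add0r -rhsE -nijN.
by rewrite rhsE kerN add0r.
Qed.

Section Tilde.
Variables (F : fieldType) (L : leibnizTripleSystemType F) (V : lmodType F).
Variables (rho : representation L V) (T : {linear V -> L}).
Implicit Types p q s : semidirect rho.
Local Notation N := (tilde rho T).

Lemma tilde_id p : p.2 = 0 -> N p = p.
Proof. by case: p => x u /= ->; rewrite /tilde /= /tilde_fun /= linear0 addr0. Qed.

Lemma sub_tilde p : p - N p = (- T p.2, p.2).
Proof.
apply: injective_projections => /=; last by rewrite subr0.
by rewrite opprD addNKr.
Qed.

Lemma tilde_triple_image p q s : N {[N p, N q, N s]} = {[N p, N q, N s]}.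
Proof. by apply: tilde_id; rewrite /= !linear0 !addr0. Qed.

(** The vectors (- T u, u) make up the kernel of N; the bracket of three of
    them lies in it again exactly when the first component below vanishes. *)
Lemma tilde_triple_kernel (u v w : V) :
  N {[(- T u, u) : semidirect rho, (- T v, v) : semidirect rho,
      (- T w, w) : semidirect rho]} =
  (T (rep_l rho (T u) (T v) w + rep_m rho (T u) (T w) v
      + rep_r rho (T v) (T w) u) - {[T u, T v, T w]}, 0).
Proof.
apply: injective_projections => //=.
rewrite tripleNNN (bilinear_to_EndNN _ _ _ (rep_l_bilinear rho)).
rewrite (bilinear_to_EndNN _ _ _ (rep_m_bilinear rho)).
by rewrite (bilinear_to_EndNN _ _ _ (rep_r_bilinear rho)) addrC.
Qed.

End Tilde.

Theorem proposition3p7 (F : fieldType) (L : leibnizTripleSystemType F)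
    (V : lmodType F) (rho : representation L V) (T : {linear V -> L}) :
  relative_rota_baxter rho T <-> nijenhuis (tilde rho T).
Proof.
have NN p : tilde rho T (tilde rho T p) = tilde rho T p by apply: tilde_id.
have nijE := idempotent_nijenhuis NN (tilde_triple_image T).
split=> [rbT | /nijE kerT u v w].
  by apply/nijE => p q s; rewrite !sub_tilde tilde_triple_kernel rbT subrr.
have := kerT (0, u) (0, v) (0, w).
by rewrite !sub_tilde tilde_triple_kernel => -[/eqP]; rewrite subr_eq0 => /eqP.
Qed.
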